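(* Let $d\ge 1$ and $h\ge 2$ be integers, and let $n_1\le n_2\le\dots\le n_d$ be positive integers. Set $N_0=1$, $N_i=\prod_{j=1}^{i}n_j$ for $1\le i\le d$, and $N=N_d$, and let $s$ be the least integer in $\{1,\dots,d\}$ such that $N^{1/h}\le n_s^{d-s+2}N_{s-1}$. Let $F_h(n_1,\dots,n_d)$ denote the largest cardinality of a $B_h$-set contained in the box $\prod_{j=1}^{d}[1,n_j]\subset\mathbb{Z}^d$. Then \[ F_h(n_1,\dots,n_d)\le \begin{cases} (t!)^{\frac{2}{h}}\,t^{\frac{d}{h}}\,N^{\frac{1}{h}}\left(1+O\left(\left(\frac{N_{s-1}}{N^{1/h}}\right)^{\frac{1}{d-s+2}}\right)\right) & \text{if } h=2t,\\[2mm] (t!)^{\frac{2}{h}}\,t^{\frac{d-1}{h}}\,N^{\frac{1}{h}}\left(1+O\left(\left(\frac{N_{s-1}}{N^{1/h}}\right)^{\frac{1}{d-s+2}}\right)\right) & \text{if } h=2t-1, \end{cases} \] where $t$ is a positive integer and the implied constants depend only on $d$ and $h$.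
   Context: For integers $n\geq 1$, $[1,n]=\{1,\dots,n\}$. A subset $S$ of an additive abelian group $G$ (here $G=\mathbb{Z}^d$) is a $B_h$-set if all sums $a_1+\dots+a_h$ with $a_1,\dots,a_h\in S$ (repetitions allowed) are distinct up to the order of the summands; that is, $a_1+\dots+a_h=b_1+\dots+b_h$ with all $a_i,b_i\in S$ implies that the multisets $\{a_1,\dots,a_h\}$ and $\{b_1,\dots,b_h\}$ are equal. *)

(* Defs.v *)
From HB Require Import structures.
From mathcomp Require Import all_boot all_order all_algebra finmap.
From mathcomp Require Import all_classical all_reals all_analysis.

Import Order.TTheory GRing.Theory Num.Theory.

Local Open Scope fset_scope.
Local Open Scope classical_set_scope.
Local Open Scope ring_scope.

(* Equality of multisets of summands is perm_eq on the tuples listing them. *)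
Definition Bh_set {G : zmodType} (h : nat) (S : set G) : Prop :=
  forall a b : h.-tuple G, [set` a] `<=` S -> [set` b] `<=` S ->
    \sum_(x <- a) x = \sum_(x <- b) x -> perm_eq a b.

(* The side lengths are n 1, ..., n d; the values of n outside [1, d] are
   irrelevant.  Coordinates are numbered from 0, hence the shift i.+1. *)
Definition box (d : nat) (n : nat -> nat) : set 'rV[int]_d :=
  [set x | forall i : 'I_d, 1 <= x 0 i <= (n i.+1)%:Z].

Definition Fh (d h : nat) (n : nat -> nat) : nat :=
  \max_(S <- fpowerset (fset_set (box d n)) | `[< Bh_set h [set` S] >]) #|` S|.

(* fset_set is fset0 on infinite sets, so finiteness of the box is what makes
   Fh meaningful; Fh_attained and Fh_max say that Fh is the largest
   cardinality of a B_h-set contained in the box. *)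
Lemma finite_box (d : nat) (n : nat -> nat) : finite_set (box d n).
Proof.
pose M := (\max_(i < d) n i.+1)%N.
pose f (u : {ffun 'I_d -> 'I_M.+1}) : 'rV[int]_d := \row_i (u i : nat)%:Z.
apply: (@sub_finite_set _ _ (f @` [set: {ffun 'I_d -> 'I_M.+1}])); last first.
  exact/finite_image/finite_finset.
move=> x xbox; exists [ffun i => inord `|x ord0 i|%N] => //.
apply/rowP => i; rewrite mxE ffunE.
have /andP[x1 xn] := xbox i.
have x0 : 0 <= x 0 i by apply: le_trans x1.
rewrite inordK ?gez0_abs// ltnS -lez_nat gez0_abs//.
by apply: le_trans xn _; rewrite lez_nat (leq_bigmax (F := fun i : 'I_d => n i.+1)).
Qed.

Lemma Fh_max (d h : nat) (n : nat -> nat) (S : {fset 'rV[int]_d}) :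
  [set` S] `<=` box d n -> Bh_set h [set` S] -> (#|` S| <= Fh d h n)%N.
Proof.
move=> Sbox SB; rewrite /Fh; apply: leq_bigmax_seq => //; last exact/asboolP.
rewrite fpowersetE; apply/fsubsetP => x xS.
by rewrite in_fset_set ?inE; [exact: Sbox | exact: finite_box].
Qed.

Lemma Fh_attained (d h : nat) (n : nat -> nat) :
  (0 < h)%N ->
  exists S : {fset 'rV[int]_d},
    [/\ [set` S] `<=` box d n, Bh_set h [set` S] & #|` S| = Fh d h n].
Proof.
move=> h0; rewrite /Fh big_seq_cond.
apply: (big_ind (fun m => exists S : {fset 'rV[int]_d},
    [/\ [set` S] `<=` box d n, Bh_set h [set` S] & #|` S| = m])).
- exists fset0; split; [by move=> x /=; rewrite inE| |by rewrite cardfs0].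
  case: h h0 => // h _ a b aS; have /= := aS (thead a).
  by rewrite inE mem_tnth => /(_ isT).
- move=> x y [S [? ? <-]] [T [? ? <-]].
  by case: (leqP #|` S| #|` T|) => _; [exists T | exists S].
- move=> S /andP[SE /asboolP SB]; exists S; split=> // x xS.
  move: SE; rewrite fpowersetE => /fsubsetP /(_ x xS).
  by rewrite in_fset_set ?inE//; exact: finite_box.
Qed.

Definition Nprod (n : nat -> nat) (i : nat) : nat :=
  (\prod_(1 <= j < i.+1) n j)%N.

Definition s_cond (R : realType) (d h : nat) (n : nat -> nat) (s : nat) : bool :=
  (Nprod n d)%:R `^ h%:R^-1 <= (n s ^ (d - s + 2) * Nprod n s.-1)%:R :> R.

Definition least_s (R : realType) (d h : nat) (n : nat -> nat) (s : nat) : Prop :=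
  [/\ (1 <= s <= d)%N, s_cond R d h n s &
      forall r : nat, (1 <= r < s)%N -> ~~ s_cond R d h n r].

(* Main.v *)
Require Import Defs.
From HB Require Import structures.
From mathcomp Require Import all_boot all_order all_algebra finmap perm.
From mathcomp Require Import all_classical all_reals all_analysis.
From mathcomp Require Import zify ring lra.

Import Order.TTheory GRing.Theory Num.Theory.

Local Open Scope ring_scope.

(** The proof is Lindstrom's window argument.  Let [S] be a B_h-set with [k] elements
    in the box and let [t] be half of [h], rounded up.  Consider the [k ^ t] ordered
    [t]-tuples of elements of [S], their sums, and all translates of a window with
    sides [u_j] and volume [U].  The shifted sums lie in a box of volume
    M = prod_j (t n_j + u_j - 1), so by Cauchy-Schwarz ([card_collisions]) at least
    (k^t U)^2 / M pairs of shifted sums coincide.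

    From above, the coincidences are counted according to whether the two tuples
    share an entry ([window_collision_bound]).  If they do not, the B_h condition says
    that the difference of the two sums determines both tuples up to order when
    [h = 2t], and does so once the first entry is fixed when [h = 2t - 1]
    ([card_disjoint_diff], [card_disjoint_diff_head]).  So these pairs contribute at
    most (t!)^2 U^2, respectively (k / t) (t!)^2 U^2, because there are U^2 pairs of
    offsets.  If they do, there are only t^2 k^(2t-1) pairs of tuples
    ([card_not_disjoint]), each contributing at most U.  Hence ([Bh_window_bound]),
    with [e = 0] for even and [e = 1] for odd [h],
    t^e k^h <= M ((t!)^2 + t^3 k^(h-1) / U).

    With U taken large the second term is negligible and M is close to t^d N if every
    [u_j] is small compared to [n_j] or equal to 1.  Let [u_j = 1] for [j < s] and let
    [u_j] be about [n_j * err] for [j >= s].  Then M <= t^d N (1 + err)^d, and U is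
    about (N / N_(s-1)) err^(d-s+1).  Since k is O(N^(1/h)) by counting [h]-fold sums
    ([Bh_card_le_order]), k^(h-1) / U is of order
    (N_(s-1) / N^(1/h)) err^-(d-s+1), which is [err] precisely for the value of [err]
    in the theorem.  The inequality defining [s] is the condition n_s err >= 1 under
    which such widths exist.  Taking [h]-th roots finishes the proof, since
    1 + C err <= (1 + C err)^h. *)

(** * Counting tuples *)

(** All such tuples are rearrangements of one of them by a permutation of the
    positions. *)
Lemma card_tuple_perm_eq (T : finType) (p : nat) (s : seq T) :
  (#|[pred a : p.-tuple T | perm_eq a s]| <= p`!)%N.
Proof.
case: (pickP [pred a : p.-tuple T | perm_eq a s]) => [a0 /= a0s|no]; last first.
  by rewrite (eq_card0 no).
rewrite -card_Sn -[leqRHS]cardsT.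
apply: leq_trans (leq_imset_card (fun w : 'S_p => [tuple tnth a0 (w i) | i < p]) _).
apply: subset_leq_card; apply/fintype.subsetP => a; rewrite inE => as_.
have /tuple_permP[w aE] : perm_eq a a0 by rewrite (perm_trans as_)// perm_sym.
by apply/imsetP; exists w; rewrite ?in_setT//; apply/val_inj.
Qed.

(** A tuple through [x] is determined by the position where [x] first occurs and
    by the other [t.-1] entries. *)
Lemma card_tuple_mem (T : finType) (t : nat) (x : T) :
  (#|[pred a : t.-tuple T | x \in (a : seq T)]| <= t * #|T| ^ t.-1)%N.
Proof.
case: t => [|r] /=.
  by rewrite leqn0; apply/eqP/eq_card0 => a; rewrite inE (tuple0 a).
pose g (u : 'I_r.+1 * r.-tuple T) : r.+1.-tuple T :=
  insubd (nseq_tuple r.+1 x) (take u.1 u.2 ++ x :: drop u.1 u.2).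
apply: (@leq_trans #|[set: 'I_r.+1 * r.-tuple T]%SET|); last first.
  by rewrite cardsT card_prod card_ord card_tuple.
apply: leq_trans (leq_imset_card g _).
apply: subset_leq_card; apply/fintype.subsetP => a; rewrite inE => xa.
have ilt : (index x a < r.+1)%N by rewrite -[X in (_ < X)%N](size_tuple a) index_mem.
have sz : size (take (index x a) a ++ drop (index x a).+1 a) == r.
  by rewrite size_cat size_takel ?size_drop ?size_tuple 1?ltnW// subSS subnKC.
apply/imsetP; exists (Ordinal ilt, Tuple sz); rewrite ?in_setT//.
apply/val_inj; rewrite val_insubd /=.
have szt : size (take (index x a) a) = index x a by rewrite size_takel ?index_size.
rewrite take_cat drop_cat szt ltnn subnn take0 drop0 cats0.
rewrite size_cat /= size_drop szt size_tuple subSS addnS subnKC// eqxx.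
by rewrite -[in LHS](cat_take_drop (index x a) a) (drop_nth x) ?nth_index// size_tuple.
Qed.

(** A pair of tuples with a common entry is counted at least once among the pairs
    of tuples through [x], for some [x].  The saving of one factor [#|T|] over all
    pairs is what makes this contribution an error term. *)
Lemma card_not_disjoint (T : finType) (t : nat) :
  (#|[pred ab : t.-tuple T * t.-tuple T | has (mem ab.1) ab.2]|
     <= t ^ 2 * #|T| ^ (2 * t).-1)%N.
Proof.
case: t => [|r].
  by rewrite leqn0; apply/eqP/eq_card0 => -[a b]; rewrite inE (tuple0 b).
set t := r.+1.
have -> : (t ^ 2 * #|T| ^ (2 * t).-1 = \sum_(x : T) (t * #|T| ^ r) * (t * #|T| ^ r))%N.
  rewrite sum_nat_const mulnACA -expnD mulnn mulnCA -expnS; congr (_ * _ ^ _)%N; lia.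
rewrite -sum1_card big_mkcond /=.
apply: (@leq_trans (\sum_(ab : t.-tuple T * t.-tuple T) \sum_(x : T)
    (x \in (ab.1 : seq T)) * (x \in (ab.2 : seq T)))%N).
  apply: leq_sum => -[a b] _ /=; rewrite inE /=; case: hasP => // -[x xb xa].
  by rewrite (bigD1 x)//= xb; rewrite inE in xa; rewrite xa.
rewrite exchange_big /=; apply: leq_sum => x _.
rewrite -(pair_bigA _ (fun a b : t.-tuple T => (x \in (a : seq T)) * (x \in (b : seq T)))%N) /=.
under eq_bigr do rewrite -big_distrr /=.
by rewrite -big_distrl /= leq_mul//; rewrite -big_mkcond sum1_card card_tuple_mem.
Qed.

(** * Collisions of a map *)

(** Cauchy-Schwarz against a constant function: expand the square as a double sum
    and apply the arithmetic-geometric inequality to each term. *)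
Lemma sqr_sum_leq (I : finType) (c : I -> nat) :
  ((\sum_i c i) ^ 2 <= #|I| * \sum_i c i ^ 2)%N.
Proof.
rewrite -(leq_pmul2l (isT : 0 < 2)%N) -mulnn big_distrlr /= big_distrr /=.
apply: (@leq_trans (\sum_i \sum_j (c i ^ 2 + c j ^ 2)))%N.
  apply: leq_sum => i _; rewrite big_distrr; apply: leq_sum => j _.
  exact: (nat_Cauchy _ _).1.
under eq_bigr do rewrite big_split sum_nat_const /=.
by rewrite big_split sum_nat_const /= -big_distrr /= -mulnDr addnn mul2n -doubleMr.
Qed.

(** The number of collisions of [g] is the sum of the squared sizes of its fibres,
    which is least when the [#|X|] points are spread evenly over [P]. *)
Lemma card_collisions (X : finType) (Y : choiceType) (P : {fset Y}) (g : X -> Y) :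
  (forall x, g x \in P) ->
  (#|X| ^ 2 <= #|` P| * #|[pred xy : X * X | g xy.1 == g xy.2]|)%N.
Proof.
move=> gP; pose g' x : P := [` gP x]%fset.
pose c (p : P) := #|[pred x | g' x == p]|.
have cE : #|X| = (\sum_p c p)%N.
  rewrite -sum1_card (partition_big g' xpredT)//=; apply: eq_bigr => p _.
  by rewrite sum1_card.
have qE : #|[pred xy : X * X | g xy.1 == g xy.2]| = (\sum_p c p ^ 2)%N.
  rewrite -sum1_card (partition_big (fun xy => g' xy.1) xpredT)//=.
  apply: eq_bigr => p _; rewrite sum1_card -mulnn -cardX /=; apply: eq_card => -[x y].
  rewrite -topredE /= !inE /= -!(inj_eq val_inj) /=.
  by case: (g x =P val p) => [->|_]; rewrite ?andbT ?andbF// eq_sym.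
by rewrite cE qE cardfE sqr_sum_leq.
Qed.

(** * Differences of sums in B_h-sets *)

(** The B_h condition for an injectively indexed set.  Indexing by a finite type
    lets tuples of elements form finite types that can be counted. *)
Definition Bh_family {T : finType} {G : zmodType} (h : nat) (f : T -> G) : Prop :=
  forall a b : seq T, size a = h -> size b = h ->
    \sum_(x <- a) f x = \sum_(x <- b) f x -> perm_eq a b.

Lemma Bh_set_family (G : zmodType) (h : nat) (S : {fset G}) :
  Bh_set h [set` S]%classic -> Bh_family h (fun x : S => val x).
Proof.
move=> SB a b sa sb eab.
have szm (c : seq S) : size c = h -> size (map val c) == h by rewrite size_map => ->.
have inS (c : seq S) : ([set` map val c] `<=` [set` S])%classic.
  by move=> x /= /mapP[y _ ->]; exact: valP.
have := SB (Tuple (szm a sa)) (Tuple (szm b sb)) (inS a) (inS b).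
by rewrite /= !big_map => /(_ eab) /(perm_map_inj val_inj).
Qed.

(** Compare multiplicities of one element: a positive multiplicity in [a] forces
    a zero one in [b], and likewise for the primed pair, so nothing can be moved
    from one side of the sum to the other. *)
Lemma perm_eq_cross (T : eqType) (a b a' b' : seq T) :
  ~~ has (mem a) b -> ~~ has (mem a') b' -> perm_eq (a ++ b') (a' ++ b) ->
  perm_eq a a' /\ perm_eq b b'.
Proof.
move=> ab ab' /seq.permP cross.
have key x : count_mem x a = count_mem x a' /\ count_mem x b = count_mem x b'.
  have := cross (pred1 x); rewrite !count_cat.
  have nab (u v : seq T) : ~~ has (mem u) v -> count_mem x u = 0%N \/ count_mem x v = 0%N.
    move=> uv; case: (boolP (x \in v)) => [xv|/count_memPn ->]; last by right.
    by left; apply/count_memPn; exact: (hasPn uv).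
  by case: (nab _ _ ab); case: (nab _ _ ab'); lia.
by split; apply/allP => x _ /=; apply/eqP; case: (key x).
Qed.

(** If two disjoint pairs have equal differences, moving the subtracted sums across
    gives two equal [p + q]-fold sums, so by the B_h condition and disjointness
    the pairs agree up to rearrangement. *)
Lemma card_disjoint_diff (T : finType) (G : zmodType) (p q : nat) (f : T -> G) (v : G) :
  Bh_family (p + q) f ->
  (#|[pred ab : p.-tuple T * q.-tuple T | ~~ has (mem ab.1) ab.2 &
       (\sum_(x <- ab.1) f x - \sum_(x <- ab.2) f x == v)%R]| <= p`! * q`!)%N.
Proof.
move=> fB; set E := (X in #|X|); case: (pickP E) => [[a b]|no]; last by rewrite (eq_card0 no).
move=> /andP[/= ab /eqP abv].
apply: (@leq_trans #|[predX [pred c : p.-tuple T | perm_eq c a]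
                        & [pred c : q.-tuple T | perm_eq c b]]|).
  apply: subset_leq_card; apply/fintype.subsetP => -[a' b'] /andP[/= ab' /eqP abv'].
  have cross : perm_eq (a' ++ b) (a ++ b').
    apply: fB; rewrite ?size_cat ?size_tuple// !big_cat /=.
    move: abv abv' => /eqP; rewrite subr_eq => /eqP -> /eqP.
    by rewrite subr_eq => /eqP ->; rewrite addrAC.
  have [pa pb] := perm_eq_cross _ _ _ _ _ ab' ab cross.
  by rewrite !inE /= pa pb.
by rewrite cardX leq_mul ?card_tuple_perm_eq.
Qed.

(** With one more summand in total than the B_h condition can handle, fix the first
    entry of the left tuple and cancel it.  The rearrangements of the remaining [p]
    entries give [p`!] in place of [p.+1`!], whence the better constant for odd [h]. *)
Lemma card_disjoint_diff_head (T : finType) (G : zmodType) (p q : nat) (f : T -> G) (v : G) :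
  Bh_family (p + q) f ->
  (#|[pred ab : p.+1.-tuple T * q.-tuple T | ~~ has (mem ab.1) ab.2 &
       (\sum_(x <- ab.1) f x - \sum_(x <- ab.2) f x == v)%R]|
     <= #|T| * (p`! * q`!))%N.
Proof.
move=> fB; rewrite -sum1_card (partition_big (fun ab => thead ab.1) xpredT)//=.
rewrite -sum_nat_const; apply: leq_sum => x _; rewrite sum1_card.
set D := [pred ab : p.-tuple T * q.-tuple T | ~~ has (mem ab.1) ab.2 &
       (\sum_(y <- ab.1) f y - \sum_(y <- ab.2) f y == v - f x)%R].
apply: leq_trans (card_disjoint_diff _ _ p q f (v - f x) fB).
pose g (ab : p.-tuple T * q.-tuple T) := ([tuple of x :: ab.1], ab.2).
apply: leq_trans (leq_imset_card g D).
apply: subset_leq_card; apply/fintype.subsetP => -[a b].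
case/tupleP: a => y a; rewrite -topredE /= !inE /= => /andP[/andP[ab abv] /eqP].
rewrite theadE => yx; subst y.
apply/imsetP; exists (a, b) => //; rewrite inE /=; apply/andP; split.
  by apply: contra ab; apply: sub_has => z za /=; rewrite inE (za : z \in a : bool) orbT.
by move: abv; rewrite big_cons /= => /eqP <-; rewrite -(addrA (f x)) [f x + _]addrC addrK.
Qed.

(** Slide a window, i.e. count the pairs of a [t]-fold sum and an offset [o] in [O]
    that land on the same point.  For disjoint tuples the collision is an equality
    between a difference of sums and a difference of offsets, and each of the
    [#|` O| ^ 2] differences of offsets has at most [r] such representations.  For
    tuples with a common entry it is enough that the first offset determines the
    second. *)
Lemma window_collision_bound (T : finType) (G : zmodType) (t r : nat) (f : T -> G)
    (O P : {fset G}) (c : G) :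
  (forall (a : t.-tuple T) o, o \in O -> \sum_(x <- a) f x + o + c \in P) ->
  (forall v : G, (#|[pred ab : t.-tuple T * t.-tuple T | ~~ has (mem ab.1) ab.2 &
       (\sum_(x <- ab.1) f x - \sum_(x <- ab.2) f x == v)%R]| <= r)%N) ->
  ((#|T| ^ t * #|` O|) ^ 2
     <= #|` P| * (r * #|` O| ^ 2 + t ^ 2 * #|T| ^ (2 * t).-1 * #|` O|))%N.
Proof.
move=> inP rep; pose s (a : t.-tuple T) := \sum_(x <- a) f x.
pose g (ao : t.-tuple T * O) : G := s ao.1 + val ao.2 + c.
have gP ao : g ao \in P by apply: inP; exact: valP.
rewrite -card_tuple cardfE -card_prod.
apply: leq_trans (card_collisions _ _ P g gP) _; rewrite leq_mul2l; apply/orP; right.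
pose dis (a b : t.-tuple T) := ~~ has (mem a) b.
pose F a b (o o' : O) : nat := (s a - s b == val o' - val o).
have gE a o b o' : (g (a, o) == g (b, o')) = (s a - s b == val o' - val o).
  rewrite /g /= (inj_eq (addIr c)) -subr_eq0 -[RHS]subr_eq0.
  by rewrite opprD opprB addrACA.
have -> : #|[pred xy | g xy.1 == g xy.2]| = (\sum_a \sum_b \sum_o \sum_o' F a b o o')%N.
  rewrite -sum1_card big_mkcond /= -(pair_bigA _ (fun x y => if g x == g y then 1 else 0)%N) /=.
  rewrite -(pair_bigA _ (fun a o => \sum_y if g (a, o) == g y then 1 else 0)%N) /=.
  apply: eq_bigr => a _; rewrite [RHS]exchange_big /=; apply: eq_bigr => o _.
  rewrite -(pair_bigA _ (fun b o' => if g (a, o) == g (b, o') then 1 else 0)%N) /=.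
  by apply: eq_bigr => b _; apply: eq_bigr => o' _; rewrite gE /F; case: (_ == _).
(* Tuples with a common entry are allowed one collision for each first offset. *)
have split_dis : (\sum_a \sum_b \sum_o \sum_o' F a b o o'
    <= \sum_a \sum_b \sum_o \sum_o' (dis a b * F a b o o')
       + \sum_(a : t.-tuple T) \sum_(b : t.-tuple T) has (mem a) b * #|{: O}|)%N.
  rewrite -big_split; apply: leq_sum => a _; rewrite -big_split; apply: leq_sum => b _ /=.
  rewrite /dis; case: has => /=; last first.
    by rewrite mul0n addn0; under [leqRHS]eq_bigr do under eq_bigr do rewrite mul1n.
  rewrite mul1n -sum1_card; apply: leq_trans (leq_addl _ _); apply: leq_sum => o _.
  apply: (@leq_trans (\sum_(o' : O) (val o' == val o + (s a - s b) :> G)%R)%N).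
    by apply: leq_sum => o' _; rewrite /F eq_sym subr_eq addrC.
  case: (boolP ((val o + (s a - s b))%R \in O)) => [oO|oO]; last first.
    by rewrite big1// => o' _; apply/eqP; rewrite eqb0; apply: contra oO => /eqP <-; exact: valP.
  rewrite (bigD1 [` oO]%fset)//= eqxx big1// => o' /negPf no.
  by apply/eqP; rewrite eqb0; apply/negP => /eqP e; rewrite -(inj_eq val_inj) /= e eqxx in no.
apply: leq_trans split_dis _; apply: leq_add.
  under eq_bigr do rewrite exchange_big /=; rewrite exchange_big /=.
  under eq_bigr do under eq_bigr do rewrite exchange_big /=.
  under eq_bigr do rewrite exchange_big /=.
  rewrite mulnC -mulnn -mulnA -sum_nat_const; apply: leq_sum => o _.
  rewrite -sum_nat_const; apply: leq_sum => o' _.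
  rewrite (pair_bigA _ (fun a b => dis a b * F a b o o')%N) /=.
  apply: leq_trans (rep (val o' - val o)); rewrite -sum1_card [leqRHS]big_mkcond /=.
  by apply: leq_sum => -[a b] _; rewrite inE /= /dis /F; case: has => //=; case: (_ == _).
rewrite (pair_bigA _ (fun a b : t.-tuple T => has (mem a) b * #|{: O}|)%N) /= -big_distrl leq_mul2r.
apply/orP; right; apply: leq_trans (card_not_disjoint T t).
by rewrite -sum1_card [leqRHS]big_mkcond /=; apply: leq_sum => -[a b] _; rewrite inE; case: has.
Qed.

(** * Sums of points of an integer box *)

(** An image of a dependent product, so that its cardinality is immediate.  The sides
    are indexed from 1 and the least corner is the origin, so that the same sets serve
    as windows of offsets and, after a translation, as ranges of sums. *)
Definition lattice_box (d : nat) (u : nat -> nat) : {fset 'rV[int]_d} :=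
  seq_fset tt [seq \row_i (o i : nat)%:Z | o : {dffun forall i : 'I_d, 'I_(u i.+1)}].

Lemma NprodE (n : nat -> nat) (d : nat) : Nprod n d = (\prod_(i < d) n i.+1)%N.
Proof. by rewrite /Nprod big_add1 big_mkord. Qed.

Lemma Nprod_gt0 (n : nat -> nat) (i : nat) :
  (forall j, (0 < j <= i)%N -> (0 < n j)%N) -> (0 < Nprod n i)%N.
Proof. by move=> n0; rewrite NprodE; apply: prodn_gt0 => j; apply: n0; exact: (ltn_ord j). Qed.

Lemma Nprod_scale (c : nat) (n : nat -> nat) (d : nat) :
  Nprod (fun j => c * n j)%N d = (c ^ d * Nprod n d)%N.
Proof. by rewrite !NprodE big_split /= prod_nat_const card_ord. Qed.

Lemma card_lattice_box (d : nat) (u : nat -> nat) : #|` lattice_box d u| = Nprod u d.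
Proof.
rewrite size_seq_fset undup_id; last first.
  rewrite map_inj_uniq ?enum_uniq// => o o' /rowP eo; apply/ffunP => i; apply/val_inj.
  by have := eo i; rewrite !mxE => -[].
rewrite size_image card_dep_ffun NprodE foldrE big_image.
by apply: eq_bigr => i _; exact: card_ord.
Qed.

Lemma mem_lattice_box (d : nat) (u : nat -> nat) (x : 'rV[int]_d) :
  reflect (forall i : 'I_d, 0 <= x 0 i < (u i.+1)%:Z) (x \in lattice_box d u).
Proof.
rewrite /lattice_box seq_fsetE; apply: (iffP mapP) => [[w _ ->] i|xu];
  first by rewrite mxE /= ltz_nat ltn_ord.
have lt i : (`|x 0%R i| < u i.+1)%N by have := xu i; lia.
exists [ffun i => Ordinal (lt i)]; rewrite ?mem_enum//; apply/rowP => i.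
by rewrite mxE ffunE /= gez0_abs//; case/andP: (xu i).
Qed.

Lemma sum_box_bounds (d : nat) (n : nat -> nat) (S : {fset 'rV[int]_d}) (a : seq S) (i : 'I_d) :
  ([set` S] `<=` box d n)%classic ->
  (size a)%:Z <= (\sum_(x <- a) val x) 0 i <= (size a * n i.+1)%N%:Z.
Proof.
move=> Sn; elim: a => [|x a IH]; first by rewrite big_nil mxE.
have x1n : 1 <= val x 0 i <= (n i.+1)%:Z := Sn _ (valP x) i.
rewrite big_cons mxE /= mulSn; move: IH x1n.
move: ((\sum_(y <- a) val y) 0 i) (val x 0 i) (size a * n i.+1)%N => y z m; lia.
Qed.

(** Each point is the sum of at most [h`!] ordered [h]-tuples, and all the sums
    lie in a box with sides [h * n j]. *)
Lemma Bh_expn_card_le (d h : nat) (n : nat -> nat) (S : {fset 'rV[int]_d}) :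
  (0 < h)%N -> ([set` S] `<=` box d n)%classic -> Bh_set h [set` S]%classic ->
  (#|` S| ^ h <= h`! * Nprod (fun j => h * n j)%N d)%N.
Proof.
move=> h0 Sn SB; pose s (a : h.-tuple S) : 'rV[int]_d := \sum_(x <- a) val x - const_mx 1.
have sP a : s a \in lattice_box d (fun j => h * n j)%N.
  apply/mem_lattice_box => i; rewrite !mxE.
  have := sum_box_bounds d n S a i Sn; rewrite size_tuple; lia.
pose s' a : lattice_box d (fun j => h * n j)%N := [` sP a]%fset.
rewrite -(card_lattice_box d) cardfE -card_tuple -sum1_card (partition_big s' xpredT)//.
rewrite mulnC cardfE -sum_nat_const; apply: leq_sum => p _; rewrite sum1_card.
have fB : Bh_family (h + 0) (fun x : S => val x) by rewrite addn0; exact: Bh_set_family.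
have := card_disjoint_diff _ _ h 0 _ (val p + const_mx 1) fB; rewrite muln1; apply: leq_trans.
apply: leq_trans (leq_imset_card fst _).
apply: subset_leq_card; apply/fintype.subsetP => a; rewrite unfold_in => ap.
have {}ap : s a = fsval p by rewrite -(eqP (ap : s' a == p)).
apply/imsetP; exists (a, [tuple]) => //.
by rewrite inE /= big_nil subr0 -ap subrK.
Qed.

(** The parity of [h] is carried by [e], which is 0 for [h = 2t] and 1 for [h = 2t - 1].
    The two cases differ in the number of representations of a difference, at most
    [t`! ^ 2] for even [h] and [#|` S| * (t.-1`! * t`!)] for odd [h]; after
    multiplication by [t] the latter becomes [#|` S| * t`! ^ 2], and the factor
    [#|` S|] lowers the exponent on the left from [2 * t] to [h]. *)
Lemma Bh_window_bound (d h t e : nat) (n u : nat -> nat) (S : {fset 'rV[int]_d}) :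
  (h + e = 2 * t)%N -> (e <= 1)%N -> (0 < t)%N -> (forall j, (0 < j <= d)%N -> (0 < u j)%N) ->
  ([set` S] `<=` box d n)%classic -> Bh_set h [set` S]%classic ->
  (t ^ e * #|` S| ^ h * Nprod u d
     <= Nprod (fun j => t * n j + u j - 1) d
        * (t`! ^ 2 * Nprod u d + t ^ 3 * #|` S| ^ h.-1))%N.
Proof.
move=> hE e1 t0 u0 Sn /Bh_set_family fB; set U := Nprod u d; set M := Nprod _ d; set k := #|` S|.
have U0 : (0 < U)%N by exact: Nprod_gt0.
case: (posnP k) => [k0|k0]; first by rewrite k0 exp0n ?muln0//; lia.
have window r : (forall v : 'rV[int]_d, (#|[pred ab : t.-tuple S * t.-tuple S |
       ~~ has (mem ab.1) ab.2 &
       (\sum_(x <- ab.1) val x - \sum_(x <- ab.2) val x == v)%R]| <= r)%N) ->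
    (k ^ (2 * t) * U <= M * (r * U + t ^ 2 * k ^ (2 * t).-1))%N.
  move=> rep.
  (* A [t]-fold sum has coordinates in [t, t n_j] and an offset in [0, u_j - 1],
     so subtracting 1 brings the total into [0, t n_j + u_j - 1). *)
  have inP (a : t.-tuple S) o : o \in lattice_box d u ->
      \sum_(x <- a) val x + o + - const_mx 1 \in lattice_box d (fun j => t * n j + u j - 1)%N.
    move=> /mem_lattice_box ou; apply/mem_lattice_box => i; rewrite !mxE.
    have := sum_box_bounds d n S a i Sn; have := ou i; rewrite size_tuple.
    by move: (_ 0 i) (o 0 i) (t * n i.+1)%N => y z m; lia.
  have := window_collision_bound S _ t r (fun x => val x) _ _ _ inP rep.
  rewrite !card_lattice_box -/U -/M -cardfE -/k => wc.
  have -> : (k ^ (2 * t) = (k ^ t) ^ 2)%N by rewrite -expnM mulnC.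
  rewrite -(leq_pmul2r U0) -mulnA mulnn -expnMn.
  by apply: leq_trans wc _; apply/eq_leq; ring.
case: e e1 hE => [|[|//]] _ hE.
  rewrite addn0 in hE; subst h; rewrite expn0 mul1n.
  apply: (leq_trans (window (t`! * t`!)%N _)).
    by move=> v; apply: card_disjoint_diff; rewrite addnn -mul2n.
  rewrite leq_mul2l mulnn leq_add2l leq_mul2r; apply/orP; right; apply/orP; right.
  by rewrite leq_pexp2l.
case: t t0 hE @M window => // t _ hE M window.
have {}hE : h = (2 * t).+1 by lia.
have {window} := window (k * (t`! * t.+1`!))%N _.
rewrite hE mulnS addSn add1n /= => W.
rewrite -(leq_pmul2l k0).
have -> : (k * (t.+1 ^ 1 * k ^ (2 * t).+1 * U) = t.+1 * (k ^ (2 * t).+2 * U))%N.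
  by rewrite [in RHS]expnS; ring.
apply: (@leq_trans (t.+1 * (M * (k * (t`! * t.+1`!) * U + t.+1 ^ 2 * k ^ (2 * t).+1)))%N).
  rewrite leq_mul2l; apply: W => v; rewrite /k cardfE.
  by apply: card_disjoint_diff_head; have -> : (t + t.+1 = h)%N by lia.
by rewrite factS [(k ^ (2 * t).+1)%N]expnS; apply/eq_leq; ring.
Qed.

(** * Choice of the window *)

Lemma powR_ratio_expn {R : realType} (x : R) (a h : nat) :
  0 <= x -> (0 < h)%N -> (x `^ (a%:R / h%:R)) ^+ h = x ^+ a.
Proof.
move=> x0 h0; rewrite -powR_mulrn ?powR_ge0// -powRrM divfK ?powR_mulrn//.
by rewrite pnatr_eq0 -lt0n.
Qed.

(** By convexity the graph lies below its chord over the unit interval. *)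
Lemma expr1D_le_chord {R : realType} (e : R) (d : nat) :
  0 <= e <= 1 -> (1 + e) ^+ d <= 1 + (2 ^+ d - 1) * e.
Proof.
move=> /andP[e0 e1]; elim: d => [|d IH]; first by rewrite !expr0 subrr mul0r addr0.
have p1 : 1 <= 2 ^+ d :> R by rewrite exprn_ege1// ler1n.
rewrite !exprS; set p := 2 ^+ d in IH p1 *; set y := (1 + e) ^+ d in IH *.
apply: (@le_trans _ _ ((1 + e) * (1 + (p - 1) * e))); first by rewrite ler_wpM2l ?addr_ge0.
by have : (p - 1) * e * (1 - e) >= 0; [rewrite !mulr_ge0 ?subr_ge0 | lra].
Qed.

(** The window has width 1 in the coordinates before [s], so that it costs nothing
    there, and width about [n j * e] in the others, which is at least 1 because
    [1 <= n s * e]. *)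
Lemma window_widths {R : realType} (d s : nat) (n : nat -> nat) (e : R) :
  (1 <= s <= d)%N ->
  (forall i, (1 <= i <= d)%N -> (0 < n i)%N) ->
  (forall i j, (1 <= i)%N -> (i <= j)%N -> (j <= d)%N -> (n i <= n j)%N) ->
  0 < e -> 1 <= (n s)%:R * e ->
  exists u : nat -> nat,
    [/\ forall j, (0 < j <= d)%N -> (0 < u j)%N,
        forall t j, (0 < j <= d)%N -> (0 < t)%N ->
          (t * n j + u j - 1)%:R <= t%:R * (n j)%:R * (1 + e)
      & (Nprod n d)%:R * (e / 2) ^+ (d - s).+1
          <= (Nprod u d)%:R * (Nprod n s.-1)%:R].
Proof.
move=> /andP[s1 sd] n0 nmono e0 nse.
pose w j := Num.truncn ((n j)%:R * e).
have wB j : (s <= j <= d)%N -> [/\ (0 < w j)%N, (w j)%:R <= (n j)%:R * e &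
    (n j)%:R * (e / 2) <= (w j)%:R].
  move=> /andP[sj jd].
  have nje : 1 <= (n j)%:R * e.
    by apply: le_trans nse _; rewrite ler_pM2r// ler_nat; exact: nmono.
  have w1 : (0 < w j)%N by rewrite /w truncn_gt0.
  have /andP[lo hi] := truncn_itv (le_trans ler01 nje).
  (* An integer part that is at least 1 loses at most a factor 2. *)
  split=> //; rewrite -/(w j) -natr1 in hi.
  have : 1 <= (w j)%:R :> R by rewrite ler1n.
  by move=> w1R; lra.
pose u j := if (j < s)%N then 1%N else w j.
exists u; split; rewrite /u.
- by move=> j /andP[_ jd]; case: (ltnP j s) => // sj; case: (wB j) => //; rewrite sj.
- move=> t j /andP[j0 jd] t0.
  have tn : (1:R) <= t%:R by rewrite ler1n.
  have nj : (1:R) <= (n j)%:R by rewrite ler1n n0// j0.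
  case: (ltnP j s) => sj.
    rewrite addnK natrM ler_peMr ?mulr_ge0//; lra.
  have [|_ wle _] := wB j; first by rewrite sj.
  apply: (@le_trans _ _ (t * n j + w j)%N%:R); first by rewrite ler_nat leq_subr.
  rewrite natrD natrM mulrDr mulr1 lerD2l; apply: le_trans wle _.
  by rewrite -mulrA ler_peMl// mulr_ge0// ltW.
- have split (v : nat -> nat) :
      Nprod v d = (Nprod v s.-1 * \prod_(s <= j < d.+1) v j)%N.
    by rewrite /Nprod prednK// (big_cat_nat s1)//= ltnW.
  rewrite -/u !split.
  have -> : Nprod u s.-1 = 1%N.
    rewrite /Nprod prednK// big_nat_cond big1// => j /andP[/andP[_ js] _].
    by rewrite /u js.
  rewrite mul1n natrM -mulrA mulrC ler_wpM2r//.
  have -> : (e / 2) ^+ (d - s).+1 = \prod_(s <= j < d.+1) (e / 2).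
    by rewrite prodr_const_nat subSn.
  rewrite !natr_prod -big_split /= !big_nat; apply: ler_prod => j /andP[sj jd].
  have [|_ _ wge] := wB j; first by rewrite sj.
  by rewrite /u ltnNge sj /= wge mulr_ge0// divr_ge0// ltW.
Qed.

Lemma Nprod_window_le {R : realType} (d t : nat) (n u : nat -> nat) (e : R) :
  (forall j, (0 < j <= d)%N -> (t * n j + u j - 1)%:R <= t%:R * (n j)%:R * (1 + e)) ->
  (Nprod (fun j => t * n j + u j - 1)%N d)%:R <= t%:R ^+ d * (Nprod n d)%:R * (1 + e) ^+ d.
Proof.
move=> H; rewrite !NprodE !natr_prod -[d in t%:R ^+ d]card_ord -[d in (1 + e) ^+ d]card_ord.
rewrite -!prodr_const -!big_split /=; apply: ler_prod => i _.
by rewrite ler0n H//= ltn_ord.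
Qed.

(** * The bound for a B_h-set in a box *)

(** The right order of magnitude with a bad constant, needed to evaluate the error
    terms of the window bound. *)
Lemma Bh_card_le_order {R : realType} (d h : nat) (n : nat -> nat) (S : {fset 'rV[int]_d}) :
  (0 < h)%N -> ([set` S] `<=` box d n)%classic -> Bh_set h [set` S]%classic ->
  (#|` S|)%:R <= (h`! * h ^ d)%:R * (Nprod n d)%:R `^ h%:R^-1 :> R.
Proof.
move=> h0 Sn SB; have := Bh_expn_card_le d h n S h0 Sn SB.
rewrite Nprod_scale mulnA -(ler_nat R) => triv.
rewrite -(ler_pXn2r h0) ?nnegrE ?mulr_ge0 ?powR_ge0//.
have XhN : ((Nprod n d)%:R `^ h%:R^-1) ^+ h = (Nprod n d)%:R :> R.
  by rewrite -[h%:R^-1]mul1r (powR_ratio_expn _ 1)// expr1.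
rewrite exprMn XhN -natrX; apply: le_trans triv _.
rewrite natrM ler_wpM2r// -natrX ler_nat -[leqLHS]expn1.
by rewrite leq_pexp2l// muln_gt0 fact_gt0 expn_gt0 h0.
Qed.

(** Here [K] stands for the cardinality, [X] for the main term N^(1/h), [U] for the
    volume of the window, [M] for that of the box containing the shifted sums, and
    [Q] for [Nprod n s.-1].  The crude bound [K <= C0 * X] turns the second term of
    the window bound into a multiple of [X ^+ h.-1], and the relation
    [Q = X * err ^+ m.+1] is what makes this at most a constant times [err * U].
    The width of the window costs a factor [(1 + err) ^+ d], of the same order. *)
Lemma expn_card_le_of_window_bound {R : realType} (d h t e m : nat) (C0 C1 K X N U M Q err : R) :
  (0 < h)%N -> (0 < t)%N -> (t <= h)%N -> (e <= d)%N -> (m <= d)%N ->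
  0 < N -> 0 < U -> 0 <= M -> 0 < Q -> 0 < err <= 1 -> 0 <= C0 -> 0 <= K -> 0 < X ->
  X ^+ h = N -> Q = X * err ^+ m.+1 ->
  K <= C0 * X ->
  t%:R ^+ e * K ^+ h * U <= M * (t`!%:R ^+ 2 * U + t%:R ^+ 3 * K ^+ h.-1) ->
  M <= t%:R ^+ d * N * (1 + err) ^+ d ->
  N * (err / 2) ^+ m <= U * Q ->
  C1 = h%:R ^+ 3 * C0 ^+ h.-1 * 2 ^+ d ->
  K ^+ h <= t`!%:R ^+ 2 * t%:R ^+ (d - e) * N * (1 + (2 ^+ d * (1 + C1) + C1) * err).
Proof.
move=> h0 t0 th ed md N0 U0 M0 Q0 /andP[err0 err1] C00 K0 X0 XhN QE KX ineq ME UE C1E.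
have C10 : 0 <= C1 by rewrite C1E !mulr_ge0// exprn_ge0.
have tf1 : 1 <= t`!%:R :> R by rewrite ler1n fact_gt0.
(* The lower bound for [U] loses a factor [2 ^+ m] to the rounding of the widths. *)
have XU : X ^+ h.-1 <= 2 ^+ d * err * U.
  have : N * (err / 2) ^+ m * 2 ^+ m <= U * Q * 2 ^+ m by rewrite ler_wpM2r// exprn_ge0.
  rewrite -mulrA -exprMn divfK ?pnatr_eq0// QE => le1.
  have {le1} : X * (X ^+ h.-1 * err ^+ m) <= X * (2 ^+ m * err * U * err ^+ m).
    rewrite mulrA -exprS prednK// XhN; apply: le_trans le1 _.
    by rewrite exprS le_eqVlt; apply/orP; left; apply/eqP; ring.
  rewrite ler_pM2l// ler_pM2r ?exprn_gt0// => le2; apply: le_trans le2 _.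
  by rewrite -!mulrA ler_wpM2r ?mulr_ge0 ?(ltW err0) ?(ltW U0)// ler_weXn2l ?ler1n.
have KU : t%:R ^+ 3 * K ^+ h.-1 <= C1 * err * U.
  apply: (@le_trans _ _ (h%:R ^+ 3 * (C0 ^+ h.-1 * X ^+ h.-1))).
    rewrite ler_pM ?exprn_ge0//; first by apply: lerXn2r; rewrite ?nnegrE ?ler_nat.
    rewrite -exprMn; apply: lerXn2r KX; rewrite nnegrE ?mulr_ge0 //; exact: ltW.
  have -> : C1 * err * U = h%:R ^+ 3 * (C0 ^+ h.-1 * (2 ^+ d * err * U)) by rewrite C1E; ring.
  by do 2! (apply: ler_wpM2l; first by rewrite exprn_ge0).
have C1e : 0 <= C1 * err by rewrite mulr_ge0// ltW.
have te0 : 0 < t%:R ^+ e :> R by rewrite exprn_gt0// ltr0n.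
have {ineq} ineq : t%:R ^+ e * K ^+ h <=
    t%:R ^+ d * N * (1 + err) ^+ d * (t`!%:R ^+ 2 * (1 + C1 * err)).
  rewrite -(ler_pM2r U0); apply: le_trans ineq _.
  rewrite -[leRHS]mulrA; apply: ler_pM => //.
    by rewrite addr_ge0 ?mulr_ge0 ?exprn_ge0 ?(ltW U0).
  rewrite [leRHS]mulrAC mulrDr mulr1 lerD2l; apply: le_trans KU _.
  have -> : t`!%:R ^+ 2 * U * (C1 * err) = t`!%:R ^+ 2 * (C1 * err * U) by ring.
  by rewrite ler_peMl ?exprn_ege1// mulr_ge0// ltW.
have dE : t%:R ^+ d = t%:R ^+ e * t%:R ^+ (d - e) :> R by rewrite -exprD subnKC.
rewrite -(ler_pM2l te0); apply: le_trans ineq _.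
rewrite dE.
have e01 : 0 <= err <= 1 by rewrite (ltW err0).
have := expr1D_le_chord err d e01; set y := (1 + err) ^+ d => yle.
have step : y * (1 + C1 * err) <= 1 + (2 ^+ d * (1 + C1) + C1) * err.
  apply: (@le_trans _ _ ((1 + 2 ^+ d * err) * (1 + C1 * err))).
    by rewrite ler_wpM2r ?addr_ge0//; apply: le_trans yle _; lra.
  have : 0 <= 2 ^+ d * err * (C1 * (1 - err)) by rewrite !mulr_ge0 ?exprn_ge0 ?subr_ge0// ltW.
  by lra.
have -> : t%:R ^+ e * t%:R ^+ (d - e) * N * y * (t`!%:R ^+ 2 * (1 + C1 * err)) =
  t%:R ^+ e * (t`!%:R ^+ 2 * t%:R ^+ (d - e) * N) * (y * (1 + C1 * err)) by ring.
rewrite -mulrA; apply: ler_wpM2l; first exact: ltW.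
by rewrite ler_wpM2l// !mulr_ge0 ?exprn_ge0// ltW.
Qed.

(** When [err <= 1] the defining inequality of [s] says that [1 <= n s * err], so a
    window with relative widths [err] exists.  When [1 < err] the factor [C0 * err]
    absorbs the crude bound. *)
Lemma Bh_box_bound {R : realType} (d h t e s : nat) (n : nat -> nat)
    (S : {fset 'rV[int]_d}) (C0 C1 X err : R) :
  (1 <= d)%N -> (2 <= h)%N -> (h + e = 2 * t)%N -> (e <= 1)%N -> (0 < t)%N ->
  (forall i, (1 <= i <= d)%N -> (0 < n i)%N) ->
  (forall i j, (1 <= i)%N -> (i <= j)%N -> (j <= d)%N -> (n i <= n j)%N) ->
  (1 <= s <= d)%N -> s_cond R d h n s ->
  ([set` S] `<=` box d n)%classic -> Bh_set h [set` S]%classic ->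
  X = (Nprod n d)%:R `^ h%:R^-1 ->
  err = ((Nprod n s.-1)%:R / X) `^ (d - s + 2)%:R^-1 ->
  C0 = (h`! * h ^ d)%:R -> C1 = h%:R ^+ 3 * C0 ^+ h.-1 * 2 ^+ d ->
  (#|` S|)%:R <= t`!%:R `^ (2 / h%:R) * t%:R `^ ((d - e)%N%:R / h%:R) * X
     * (1 + (2 ^+ d * (1 + C1) + C1 + C0) * err).
Proof.
move=> d1 h2 hE e1 t0 n0 nmono sd scond Sn SB XE errE C0E C1E.
have h0 : (0 < h)%N by lia.
have [s1 sled] := andP sd.
have [th [ed md]] : (t <= h)%N /\ (e <= d)%N /\ ((d - s).+1 <= d)%N by lia.
set N : R := (Nprod n d)%:R in XE.
set Q : R := (Nprod n s.-1)%:R in errE.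
have N0 : 0 < N by rewrite ltr0n; exact: Nprod_gt0.
have Q0 : 0 < Q by rewrite ltr0n; apply: Nprod_gt0 => j jd; apply: n0; lia.
have X0 : 0 < X by rewrite XE powR_gt0.
have XhN : X ^+ h = N.
  by rewrite XE -[h%:R^-1]mul1r (powR_ratio_expn _ 1) ?expr1// ltW.
have C00 : 0 <= C0 by rewrite C0E.
have C10 : 0 <= C1 by rewrite C1E !mulr_ge0 ?exprn_ge0.
have err0 : 0 < err by rewrite errE powR_gt0// divr_gt0.
have KX : (#|` S|)%:R <= C0 * X by rewrite C0E XE; exact: Bh_card_le_order.
set A := t`!%:R `^ (2 / h%:R) * t%:R `^ ((d - e)%N%:R / h%:R).
have Ah : A ^+ h = t`!%:R ^+ 2 * t%:R ^+ (d - e) by rewrite exprMn !powR_ratio_expn.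
have A0 : 0 <= A by rewrite mulr_ge0 ?powR_ge0.
have C2 : 0 <= 2 ^+ d * (1 + C1) + C1 by rewrite addr_ge0 ?mulr_ge0 ?exprn_ge0 ?addr_ge0.
have Cerr : 0 <= (2 ^+ d * (1 + C1) + C1 + C0) * err.
  by rewrite mulr_ge0 ?(ltW err0)// addr_ge0.
have [err1|err1] := leP err 1; last first.
  have A1 : 1 <= A.
    by rewrite -(expr_ge1 h0 A0) Ah -!natrX -natrM ler1n muln_gt0 !expn_gt0 fact_gt0 t0.
  apply: le_trans KX _; rewrite -mulrA [leRHS]mulrCA [leLHS]mulrC ler_wpM2l ?(ltW X0)//.
  apply: (@le_trans _ _ (1 + (2 ^+ d * (1 + C1) + C1 + C0) * err)).
    have : 0 <= (2 ^+ d * (1 + C1) + C1) * err by rewrite mulr_ge0// ltW.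
    have : 0 <= C0 * (err - 1) by rewrite mulr_ge0// subr_ge0 ltW.
    lra.
  by rewrite ler_peMl// addr_ge0.
pose m := (d - s).+1.
have errm : err ^+ m.+1 = Q / X.
  have -> : m.+1 = (d - s + 2)%N by rewrite /m addn2.
  rewrite errE -[(d - s + 2)%N%:R^-1]mul1r (powR_ratio_expn _ 1) ?expr1 ?addn2//.
  by rewrite divr_ge0 ?ltW.
have nse : 1 <= (n s)%:R * err.
  rewrite -(@expr_ge1 _ m.+1)// ?mulr_ge0 ?(ltW err0)// exprMn errm mulrA ler_pdivlMr// mul1r.
  by move: scond; rewrite /s_cond -/N -XE natrM natrX addn2.
have [u [u0 uM uU]] := window_widths d s n err sd n0 nmono err0 nse.
have U0 : (0 < Nprod u d)%N by exact: Nprod_gt0.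
have ineq := Bh_window_bound d h t e n u S hE e1 t0 u0 Sn SB.
rewrite -(ler_nat R) !(natrM, natrD, natrX) in ineq.
have ME := Nprod_window_le d t n u err (fun j jd => uM t j jd t0).
have U0R : (0 : R) < (Nprod u d)%:R by rewrite ltr0n.
have eX : Q = X * err ^+ m.+1 by rewrite errm mulrC divfK// gt_eqF.
have err01 : 0 < err <= 1 by rewrite err0.
have final := expn_card_le_of_window_bound d h t e m C0 C1 _ X N _ _ Q err
  h0 t0 th ed md N0 U0R (ler0n _ _) Q0 err01 C00 (ler0n _ _) X0 XhN eX KX ineq ME uU C1E.
rewrite -(ler_pXn2r h0) ?nnegrE//; last by rewrite !mulr_ge0 ?addr_ge0 ?(ltW X0).
rewrite exprMn [(A * X) ^+ h]exprMn Ah XhN; apply: (le_trans final).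
apply: ler_wpM2l; first by rewrite !mulr_ge0 ?exprn_ge0// ltW.
have le1 : 1 + (2 ^+ d * (1 + C1) + C1) * err <= 1 + (2 ^+ d * (1 + C1) + C1 + C0) * err.
  by rewrite lerD2l ler_wpM2r ?(ltW err0)// lerDl.
apply: le_trans le1 _; by apply: ler_eXnr => //; rewrite lerDl.
Qed.

Theorem theorem5 (R : realType) (d h : nat) (hd : (1 <= d)%N) (hh : (2 <= h)%N) :
  exists C : R, 0 < C /\
    forall (n : nat -> nat) (s t : nat),
      (forall i, (1 <= i <= d)%N -> (0 < n i)%N) ->
      (forall i j, (1 <= i)%N -> (i <= j)%N -> (j <= d)%N -> (n i <= n j)%N) ->
      least_s R d h n s ->
      (0 < t)%N ->
      let N : R := (Nprod n d)%:R in
      let err : R :=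
        ((Nprod n s.-1)%:R / N `^ h%:R^-1) `^ (d - s + 2)%:R^-1 in
      (h = (2 * t)%N ->
        (Fh d h n)%:R <=
          (t`!)%:R `^ (2 / h%:R) * t%:R `^ (d%:R / h%:R) * N `^ h%:R^-1
          * (1 + C * err)) /\
      (h = (2 * t - 1)%N ->
        (Fh d h n)%:R <=
          (t`!)%:R `^ (2 / h%:R) * t%:R `^ ((d - 1)%:R / h%:R) * N `^ h%:R^-1
          * (1 + C * err)).
Proof.
pose C0 : R := (h`! * h ^ d)%:R.
pose C1 : R := h%:R ^+ 3 * C0 ^+ h.-1 * 2 ^+ d.
have C10 : 0 <= C1 by rewrite !mulr_ge0 ?exprn_ge0.
exists (2 ^+ d * (1 + C1) + C1 + C0); split.
  by rewrite ltr_wpDr// ltr_wpDr// mulr_gt0 ?exprn_gt0// ltr_wpDr.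
move=> n s t n0 nmono [sd scond _] t0 N err.
have [S [Sn SB <-]] := Fh_attained d h n (ltnW hh).
have bound e he e1 := Bh_box_bound d h t e s n S C0 C1 _ _ hd hh he e1 t0 n0 nmono sd scond Sn SB
  erefl erefl erefl erefl.
split=> hE.
  have hE0 : (h + 0 = 2 * t)%N by rewrite addn0.
  by have := bound 0%N hE0 isT; rewrite subn0.
have hE1 : (h + 1 = 2 * t)%N by lia.
exact: bound 1%N hE1 isT.
Qed.
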